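(* Every finite subcubic bipartite graph $G$ with bipartition classes $U,W$ satisfies Frankl's conjecture: if $G$ has at least one edge, then each of $U$ and $W$ contains a vertex belonging to at most half of the maximal stable sets of $G$.
   Context: A graph is subcubic if no vertex has degree greater than $3$. A set of vertices is stable if no two are adjacent; maximal means maximal under inclusion. (Edgeless graphs are considered to satisfy Frankl's conjecture trivially.) *)

(* Defs.v *)
From mathcomp Require Import all_boot.

Set Implicit Arguments.
Unset Strict Implicit.
Unset Printing Implicit Defensive.

(* A finite simple graph is a symmetric irreflexive relation e on a finType. *)
Section Graph.

Variables (T : finType) (e : rel T).

Definition simple_graph : Prop := symmetric e /\ irreflexive e.

Definition degree (x : T) : nat := #|[set y | e x y]|.

Definition subcubic : Prop := forall x, degree x <= 3.

Definition stable (S : {set T}) : bool :=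
  [forall x in S, forall y in S, ~~ e x y].

(* A class may be empty, and isolated vertices may lie in either class. *)
Definition bipartition (U W : {set T}) : Prop :=
  [/\ U :|: W = [set: T], [disjoint U & W], stable U & stable W].

Definition max_stable_sets : {set {set T}} := [set S | maxset stable S].

Definition in_at_most_half (x : T) : Prop :=
  2 * #|[set S in max_stable_sets | x \in S]| <= #|max_stable_sets|.

(* Frankl's conjecture for the bipartite graph e with classes U and W;
   edgeless graphs satisfy it trivially. *)
Definition satisfies_frankl (U W : {set T}) : Prop :=
  (exists x y, e x y) ->
  (exists2 u, u \in U & in_at_most_half u) /\
  (exists2 w, w \in W & in_at_most_half w).

End Graph.

(* Main.v *)
(** A maximal stable set [S] is determined by the set [U :\: S] it misses, and
these sets form a union-closed family [F] generated by the neighbourhoods of the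
vertices of [W].  A vertex of [U] lies in at most half of the maximal stable
sets iff it lies in at least half of the members of [F].  The generators have at
most three points and each point lies in at most three of them.

Fix either a generator with at most two points, or a point [a] together with all
generators through it, which may then be assumed to be triples.  Let [N t] count
the members of [F] whose trace on these generators is [t].  Comparing members
that agree outside the configuration gives [N s + N t <= N (s \/ t) + N v]
whenever [v] arises from [s] and from [t] by adding generators; moreover
[N t = 0] if [t] contains [a] but none of the generators through [a].  For each of
the ten possible configurations a nonnegative combination of these inequalities
shows that a weighted average of the frequencies of its points is at least one
half. *)

Require Import Defs.
From mathcomp Require Import all_boot zify.

Set Implicit Arguments.
Unset Strict Implicit.
Unset Printing Implicit Defensive.

(** * Certificates on bit sequences *)

Definition bitor (s t : bitseq) : bitseq := [seq p.1 || p.2 | p <- zip s t].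

Fixpoint bits (m n : nat) : bitseq :=
  if m is m'.+1 then odd n :: bits m' n./2 else [::].

Fixpoint cube (m : nat) : seq bitseq :=
  if m is m'.+1 then [seq b :: t | b <- [:: true; false], t <- cube m']
  else [:: [::]].

Lemma mem_cube (t : bitseq) : t \in cube (size t).
Proof.
elim: t => // b t IHt /=; rewrite cats0 mem_cat.
by case: b; rewrite map_f ?orbT.
Qed.

(** What can be reached from [t] by adding generators from [Ms], possibly none. *)
Definition joins (Ms : seq bitseq) (t : bitseq) : seq bitseq :=
  foldr (fun A r => r ++ [seq bitor s A | s <- r]) [:: t] Ms.

(* [(k, (s, t, v))] stands for [k] times the inequality
   [N s + N t <= N (bitor s t) + N v]; for [v = t], [s <= t] it says
   [N s <= N t]. *)
Definition instance := (nat * (bitseq * bitseq * bitseq))%type.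

Definition lhs_coef (t : bitseq) (i : instance) : nat :=
  i.1 * ((t == i.2.1.1) + (t == i.2.1.2)).

Definition rhs_coef (t : bitseq) (i : instance) : nat :=
  i.1 * ((t == bitor i.2.1.1 i.2.1.2) + (t == i.2.2)).

Definition admissible (Ms : seq bitseq) (i : instance) : bool :=
  (i.2.2 \in joins Ms i.2.1.1) && (i.2.2 \in joins Ms i.2.1.2).

(** Dual feasibility at [t]: summed over the members of the family, with the certificate cancelled,
    it says that weighted memberships are at least as many as weighted non-memberships. *)
Definition balanced (c : seq nat) (cert : seq instance) (t : bitseq) : bool :=
  sumn (mask (map negb t) c) + sumn (map (rhs_coef t) cert)
    <= sumn (mask t c) + sumn (map (lhs_coef t) cert).

(** Traces that fail this test contain the first point but no generator; with [loc] they do not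
    occur and are skipped. *)
Definition localized (Ms : seq bitseq) (t : bitseq) : bool :=
  head false t ==> has (fun A => bitor A t == t) Ms.

Definition certifies (m : nat) (Ms : seq bitseq) (loc : bool) (c : seq nat)
    (cert : seq instance) : bool :=
  [&& 0 < sumn c, size c == m, all (fun A => size A == m) Ms,
      all (admissible Ms) cert &
      all (fun t => (loc ==> localized Ms t) ==> balanced c cert t) (cube m)].

(** * Counting members of a union-closed family by trace *)

Section Trace.

Variables (T : finType) (F : {set {set T}}).
Hypothesis FU : {in F &, forall X Y, X :|: Y \in F}.
Variable es : seq T.

Definition trace (X : {set T}) : bitseq := [seq x \in X | x <- es].

Lemma trace_setU (X Y : {set T}) : trace (X :|: Y) = bitor (trace X) (trace Y).
Proof. by rewrite /trace /bitor; elim: es => //= x s ->; rewrite inE. Qed.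

Lemma trace_mask (A : bitseq) :
  uniq es -> size A = size es -> trace [set:: mask A es] = A.
Proof.
rewrite /trace; elim: es A => [|x s IHs] [|b A] //= /andP[xs us] [sA].
have mx : x \notin mask A s by apply: contra xs; apply: mem_mask.
congr (_ :: _).
  by rewrite inE; case: b; rewrite ?mem_head // (negPf mx).
rewrite -[RHS](IHs A us sA); apply/eq_in_map => y ys.
rewrite !inE; case: b; rewrite ?inE //.
by case: eqP => // yx; rewrite -yx ys in xs.
Qed.

Lemma trace_inj (X Y : {set T}) :
  trace X = trace Y -> X :\: [set:: es] = Y :\: [set:: es] -> X = Y.
Proof.
move=> /eq_in_map tXY /setP XY; apply/setP=> x.
have := XY x; rewrite !inE; case xs: (x \in es) => //= _; exact: tXY.
Qed.

Definition fiber (t : bitseq) : {set {set T}} := [set X in F | trace X == t].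

(** Trace and residue together determine a member, so fibers over different traces can be compared
    through their residues. *)
Definition residues (t : bitseq) : {set {set T}} :=
  [set X :\: [set:: es] | X in fiber t].

Lemma card_residues (t : bitseq) : #|residues t| = #|fiber t|.
Proof.
apply: card_in_imset => X Y; rewrite !inE => /andP[_ /eqP tX] /andP[_ /eqP tY].
by apply: trace_inj; rewrite tX.
Qed.

Variable Ms : seq bitseq.
Hypotheses (ues : uniq es) (szMs : all (fun A => size A == size es) Ms).
Hypothesis FM : {in Ms, forall A, [set:: mask A es] \in F}.

(** The generators lie inside the configuration, so adding them changes the trace of a member but
    not its residue. *)
Lemma residues_joins (t v : bitseq) :
  v \in joins Ms t -> residues t \subset residues v.
Proof.
elim: Ms szMs FM v => [|A s IHs] /=.
  by move=> _ _ v; rewrite inE => /eqP->.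
move=> /andP[/eqP sA ss] FA v.
have {}IHs := IHs ss (fun B Bs => FA B (mem_behead (s := A :: s) Bs)).
rewrite mem_cat => /orP[/IHs//|/mapP[w /IHs tw ->]].
apply: subset_trans tw _; apply/subsetP=> _ /imsetP[X + ->].
rewrite inE => /andP[XF /eqP tX].
have AF := FA A (mem_head _ _).
apply/imsetP; exists (X :|: [set:: mask A es]).
  by rewrite inE FU // trace_setU tX trace_mask //=.
rewrite setDUl; have -> : [set:: mask A es] :\: [set:: es] = set0.
  apply/eqP; rewrite setD_eq0; apply/subsetP=> x; rewrite !inE.
  exact: mem_mask.
by rewrite setU0.
Qed.

(** Residues common to [s] and [t] occur over [bitor s t], by uniting two members with equal
    residue; residues of either occur over [v]. Inclusion-exclusion does the rest. *)
Lemma fiber_union (s t v : bitseq) :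
  v \in joins Ms s -> v \in joins Ms t ->
  #|fiber s| + #|fiber t| <= #|fiber (bitor s t)| + #|fiber v|.
Proof.
move=> /residues_joins sv /residues_joins tv.
rewrite -!card_residues -cardsUI addnC leq_add //; last first.
  by apply: subset_leq_card; rewrite subUset sv.
apply: subset_leq_card; apply/subsetP=> Z /setIP[/imsetP[X + ->] /imsetP[Y]].
rewrite !inE => /andP[XF /eqP tX] /andP[YF /eqP tY] XY.
apply/imsetP; exists (X :|: Y); first by rewrite inE FU // trace_setU tX tY /=.
by rewrite setDUl -XY setUid.
Qed.

Lemma sum_fiber (t : bitseq) : \sum_(X in F) (trace X == t) = #|fiber t|.
Proof.
rewrite -sum1_card big_mkcond [RHS]big_mkcond /=; apply: eq_bigr => X _.
by rewrite inE; case: (X \in F); case: eqP.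
Qed.

Lemma sum_coef (cert : seq instance) : all (admissible Ms) cert ->
  \sum_(X in F) sumn (map (lhs_coef (trace X)) cert)
    <= \sum_(X in F) sumn (map (rhs_coef (trace X)) cert).
Proof.
elim: cert => [_|[k [[s t] v]] r IHr /= /andP[/andP[/= sv tv] /IHr {}IHr]].
  by rewrite !big1.
rewrite !big_split leq_add // /lhs_coef /rhs_coef /= -!big_distrr leq_mul //=.
by rewrite !big_split /= !sum_fiber fiber_union.
Qed.

(** Double counting, with [P] general to serve both membership and non-membership. *)
Lemma sum_weight (P : T -> {set T} -> bool) (c : seq nat) :
  \sum_(X in F) sumn (mask [seq P x X | x <- es] c)
    = \sum_(p <- zip c es) p.1 * #|[set X in F | P p.2 X]|.
Proof.
elim: es c => [|x s IHs] [|k c] /=; try by rewrite big_nil big1.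
rewrite big_cons -IHs /=.
have -> : #|[set X in F | P x X]| = \sum_(X in F) P x X.
  rewrite -sum1_card big_mkcond [RHS]big_mkcond /=; apply: eq_bigr => X _.
  by rewrite inE; case: (X \in F); case: (P x X).
rewrite big_distrr -big_split /=; apply: eq_bigr => X _.
by case: (P x X); rewrite /= ?muln1 ?muln0.
Qed.

Lemma abundant_of_certificate (loc : bool) (c : seq nat) (cert : seq instance) :
  (loc -> {in F, forall X, head false (trace X) ->
    exists2 A, A \in Ms & [set:: mask A es] \subset X}) ->
  certifies (size es) Ms loc c cert ->
  exists2 x, x \in es & #|F| <= 2 * #|[set X in F | x \in X]|.
Proof.
move=> locF /and5P[c0 /eqP sc _ cadm /allP cbal].
have bal X : X \in F -> balanced c cert (trace X).
  move=> XF; have := cbal (trace X).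
  rewrite -[X in cube X](size_map (fun x => x \in X)) mem_cube => /(_ isT).
  move/implyP; apply; apply/implyP => /locF {}locF.
  rewrite /localized; apply/implyP => hX.
  have [A AM AX] := locF X XF hX.
  apply/hasP; exists A => //.
  have /eqP sA := allP szMs A AM.
  by rewrite -{1}[A]trace_mask // -trace_setU (setUidPr AX).
have tot : \sum_(p <- zip c es) p.1 * #|[set X in F | p.2 \notin X]|
             <= \sum_(p <- zip c es) p.1 * #|[set X in F | p.2 \in X]|.
  rewrite -(sum_weight (fun x X => x \notin X)).
  rewrite -(sum_weight (fun x (X : {set T}) => x \in X)).
  have : \sum_(X in F) (sumn (mask (map negb (trace X)) c)
            + sumn (map (rhs_coef (trace X)) cert))
      <= \sum_(X in F) (sumn (mask (trace X) c)
            + sumn (map (lhs_coef (trace X)) cert)) by apply: leq_sum.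
  have -> : \sum_(X in F) sumn (mask [seq x \notin X | x <- es] c)
          = \sum_(X in F) sumn (mask (map negb (trace X)) c).
    by apply: eq_bigr => X _; rewrite -map_comp.
  by have := sum_coef cadm; rewrite !big_split /trace /=; lia.
case: (boolP (has (fun x => #|F| <= 2 * #|[set X in F | x \in X]|) es)).
  by case/hasP => x xes xF; exists x.
move=> /hasPn rare; suff: false by [].
have cpl x : #|[set X in F | x \in X]| + #|[set X in F | x \notin X]| = #|F|.
  rewrite -[RHS](cardsID [set X : {set T} | x \in X] F).
  by congr (_ + _); apply: eq_card => X; rewrite !inE // andbC.
(* A rare point has at least one more non-member than members containing it; the weighted gaps total
   at least [sumn c], which is positive, against [tot]. *)
have : \sum_(p <- zip c es) (p.1 * #|[set X in F | p.2 \in X]| + p.1)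
    <= \sum_(p <- zip c es) p.1 * #|[set X in F | p.2 \notin X]|.
  rewrite big_seq [X in _ <= X]big_seq; apply: leq_sum => -[k x] /= kx.
  have xes : x \in es.
    by rewrite -[es](@unzip2_zip _ _ c) ?sc //; apply: (map_f snd kx).
  rewrite addnC -mulnS leq_mul //; have := rare x xes; 
  by rewrite /= -ltnNge -(cpl x) mul2n -addnn ltn_add2l.
rewrite big_split /= => le1.
have : \sum_(p <- zip c es) p.1 = sumn c.
  by rewrite -[in RHS](@unzip1_zip _ _ c es) ?sc // sumnE big_map.
move=> wc; have := leq_trans le1 tot.
by rewrite -[X in _ <= X]addn0 leq_add2l wc leqNgt c0.
Qed.

End Trace.

(** * Certificates for the configurations of triples through a point *)

(* Traces are written as numbers, the bit of weight [2 ^ i] standing for the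
   [i]-th point.  The inequalities were found by linear programming over their
   averages under a group [ps] of automorphisms of the configuration. *)
Definition decode (m : nat) (ps : seq (seq nat))
    (cert : seq (nat * (nat * nat * nat))) : seq instance :=
  let act p n := [seq nth false (bits m n) i | i <- p] in
  [seq (i.1, (act p i.2.1.1, act p i.2.1.2, act p i.2.2)) | p <- ps, i <- cert].

(** The weights are scaled by [size ps] because [decode] repeats each inequality once per
    symmetry. *)
Definition certified (m : nat) (Ms : seq nat) (loc : bool) (ps : seq (seq nat))
    (c : seq nat) (cert : seq (nat * (nat * nat * nat))) : bool :=
  certifies m (map (bits m) Ms) loc (map (muln (size ps)) c)
    (decode m ps cert).

Lemma cert_singleton :
  certified 1 [:: 1] false [:: iota 0 1] [:: 1] [:: (1, (0, 1, 1))].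
Proof. by vm_compute. Qed.

Lemma cert_pair :
  certified 2 [:: 3] false [:: iota 0 2] [:: 1; 1] [:: (2, (0, 3, 3))].
Proof. by vm_compute. Qed.

Lemma cert_triple :
  certified 3 [:: 7] true [:: iota 0 3] [:: 0; 1; 1] [:: (2, (0, 7, 7))].
Proof. by vm_compute. Qed.

Lemma cert_two_overlapping :
  certified 4 [:: 7; 11] true [:: iota 0 4] [:: 0; 1; 1; 0]
    [:: (2, (0, 7, 7)); (2, (8, 15, 15))].
Proof. by vm_compute. Qed.

Lemma cert_two_disjoint :
  certified 5 [:: 7; 25] true [:: iota 0 5] [:: 0; 1; 1; 1; 1]
    [:: (2, (0, 7, 7)); (2, (4, 29, 29)); (2, (0, 31, 31)); (2, (2, 27, 27));
        (2, (8, 15, 15)); (2, (7, 16, 31))].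
Proof. by vm_compute. Qed.

(* In the next five lemmas the triples minus their common point form, as edges
   of a graph, a triangle, a star, a path, a path of length two plus a disjoint
   edge, and a perfect matching. *)
Lemma cert_triangle :
  certified 4 [:: 7; 11; 13] true [:: iota 0 4] [:: 0; 1; 1; 1]
    [:: (1, (8, 13, 13)); (3, (0, 15, 15)); (1, (2, 4, 7))].
Proof. by vm_compute. Qed.

Lemma cert_star :
  certified 5 [:: 7; 11; 19] true
    [:: [:: 0; 1; 2; 3; 4]; [:: 0; 1; 2; 4; 3]; [:: 0; 1; 3; 2; 4];
        [:: 0; 1; 3; 4; 2]; [:: 0; 1; 4; 2; 3]; [:: 0; 1; 4; 3; 2]]
    [:: 0; 1; 1; 1; 1]
    [:: (2, (4, 8, 15)); (2, (4, 24, 31)); (2, (2, 28, 31)); (4, (0, 15, 15))].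
Proof. by vm_compute. Qed.

Lemma cert_path :
  certified 5 [:: 7; 13; 25] true [:: [:: 0; 1; 2; 3; 4]; [:: 0; 4; 3; 2; 1]]
    [:: 0; 1; 1; 1; 1]
    [:: (4, (2, 27, 27)); (4, (4, 29, 29)); (4, (0, 7, 7)); (2, (7, 25, 31))].
Proof. by vm_compute. Qed.

Lemma cert_path_edge :
  certified 6 [:: 7; 11; 49] true
    [:: [:: 0; 1; 2; 3; 4; 5]; [:: 0; 1; 3; 2; 4; 5]; [:: 0; 1; 2; 3; 5; 4];
        [:: 0; 1; 3; 2; 5; 4]]
    [:: 3; 5; 3; 3; 4; 4]
    [:: (28, (16, 23, 23)); (20, (20, 23, 23)); (4, (7, 20, 55));
        (2, (2, 28, 63)); (8, (6, 20, 55)); (6, (2, 51, 51)); (32, (4, 53, 53));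
        (22, (0, 55, 55)); (6, (12, 48, 63)); (4, (6, 12, 15)); (4, (2, 7, 7));
        (1, (60, 61, 61)); (2, (14, 55, 63)); (2, (14, 15, 15));
        (10, (53, 57, 63)); (10, (23, 27, 31)); (1, (28, 44, 61));
        (4, (18, 34, 51))].
Proof. by vm_compute. Qed.

(** The 48 automorphisms of three disjoint edges: permute the edges and flip each one, the edges
    being the pairs [2i+1], [2i+2]. *)
Definition matching_symmetries : seq (seq nat) :=
  [seq 0 :: flatten [seq (let b := nth false f i in
                          [:: (2 * i).+1 + b; (2 * i).+2 - b]) | i <- p]
     | p <- permutations (iota 0 3), f <- cube 3].

Lemma cert_matching :
  certified 7 [:: 7; 25; 97] true matching_symmetries [:: 1; 1; 1; 1; 1; 1; 1]
    [:: (4, (6, 24, 31)); (7, (0, 97, 97)); (4, (42, 44, 47)); (5, (14, 103, 127));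
        (10, (2, 25, 31)); (8, (10, 98, 123)); (1, (10, 12, 15));
        (17, (10, 99, 123)); (19, (2, 99, 99)); (1, (2, 57, 127));
        (1, (6, 120, 127)); (9, (10, 107, 107))].
Proof. by vm_compute. Qed.

(** * Union-closed families generated by small sets *)

Section Generated.

Variables (T : finType) (F G : {set {set T}}).
Hypothesis FU : {in F &, forall X Y, X :|: Y \in F}.
Hypothesis GF : {subset G <= F}.
Hypothesis FG : forall X x, X \in F -> x \in X ->
  exists2 A, A \in G & (x \in A) && (A \subset X).

Definition abundant (x : T) : bool := #|F| <= 2 * #|[set X in F | x \in X]|.

Lemma set_extend (A : {set T}) (s : seq T) :
  uniq s -> {subset s <= A} ->
  exists2 r, uniq (s ++ r) & A = [set:: s ++ r].
Proof.
move=> us sA; exists (enum (A :\: [set:: s])).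
  rewrite cat_uniq us enum_uniq andbT; apply/hasPn => x.
  by rewrite mem_enum !inE => /andP[].
apply/setP=> x; rewrite inE mem_cat mem_enum !inE.
by case xs: (x \in s) => //=; rewrite sA.
Qed.

Lemma triple_through (A : {set T}) (a : T) :
  #|A| = 3 -> a \in A ->
  exists b c, uniq [:: a; b; c] /\ A = [set:: [:: a; b; c]].
Proof.
move=> A3 aA; have [x|r u eA] := @set_extend A [:: a] isT.
  by rewrite inE => /eqP->.
move: A3; rewrite {1}eA cardsE (card_uniqP u).
by case: r u eA => [|b [|c []]] //= u eA _; exists b, c.
Qed.

Lemma triple_through2 (A : {set T}) (a b : T) :
  #|A| = 3 -> a != b -> a \in A -> b \in A ->
  exists2 c, uniq [:: a; b; c] & A = [set:: [:: a; b; c]].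
Proof.
move=> A3 ab aA bA; have [||r u eA] := @set_extend A [:: a; b].
- by rewrite /= inE ab.
- by move=> x; rewrite !inE => /orP[] /eqP->.
move: A3; rewrite {1}eA cardsE (card_uniqP u).
by case: r u eA => [|c []] //= u eA _; exists c.
Qed.

Lemma size_bits (m n : nat) : size (bits m n) = m.
Proof. by elim: m n => //= m IHm n; rewrite IHm. Qed.

(** By [FG] a member containing the first point contains a generator through it, which [locG] places
    among those listed in [Ms]. *)
Lemma abundant_of_certified (es : seq T) (Ms : seq nat) (loc : bool) ps c cert :
  uniq es ->
  {in Ms, forall M, [set:: mask (bits (size es) M) es] \in G} ->
  (loc -> forall A, A \in G -> head false (trace es A) ->
     A \in [seq [set:: mask (bits (size es) M) es] | M <- Ms]) ->
  certified (size es) Ms loc ps c cert -> exists x, abundant x.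
Proof.
move=> u MG locG cert_ok.
have [|||x _ xab] := @abundant_of_certificate T F FU es
  (map (bits (size es)) Ms) u _ _ loc _ _ _ cert_ok; last by exists x.
- by apply/allP=> _ /mapP[M _ ->]; rewrite size_bits.
- by move=> _ /mapP[M MMs ->]; apply/GF/MG.
move=> /locG {}locG X XF; case: es u MG locG cert_ok => //= a s u _ locG _ aX.
have [A AG /andP[aA AX]] := FG XF aX.
have /mapP[M MMs eA] := locG A AG aA.
by exists (bits (size s).+1 M); [apply: map_f | rewrite -eA].
Qed.

(** Adding [A] injects the members disjoint from [A] into those containing it; if [A] has two
    points, every other member contains exactly one of them. *)
Lemma abundant_of_small (A : {set T}) :
  A \in G -> 0 < #|A| <= 2 -> exists x, abundant x.
Proof.
move=> AG A12; have [//|r /= u eA] := @set_extend A [::] isT.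
have cA : #|A| = size r by rewrite eA cardsE (card_uniqP u).
move: A12; rewrite {}cA.
case: r u eA => [|a [|b []]] //= u eA _.
  apply: (abundant_of_certified (es := [:: a]) _ _ _ cert_singleton) => // M.
  by rewrite inE => /eqP-> /=; rewrite -eA.
apply: (abundant_of_certified (es := [:: a; b]) _ _ _ cert_pair) => // M.
by rewrite inE => /eqP-> /=; rewrite -eA.
Qed.

Lemma abundant_of_triples (a : T) (s : seq T) (L : seq {set T})
    (Ms : seq nat) ps c cert :
  uniq (a :: s) ->
  (forall A, (A \in L) = (A \in G) && (a \in A)) ->
  [seq [set:: mask (bits (size s).+1 M) (a :: s)] | M <- Ms] =i L ->
  certified (size s).+1 Ms true ps c cert -> exists x, abundant x.
Proof.
move=> u LG eL; apply: (abundant_of_certified (es := a :: s)) => //=.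
  move=> M MMs.
  have : [set:: mask (bits (size s).+1 M) (a :: s)] \in L.
    rewrite -eL.
    exact: (map_f (fun M => [set:: mask (bits (size s).+1 M) (a :: s)])).
  by rewrite LG => /andP[].
by move=> _ A AG aA; rewrite eL LG AG.
Qed.

(** * Case analysis on the triples through a point *)

Lemma abundant_of_one_triple (a : T) (A : {set T}) :
  (forall B, (B \in [:: A]) = (B \in G) && (a \in B)) -> #|A| = 3 ->
  exists x, abundant x.
Proof.
move=> LG A3; have /andP[_ aA] : (A \in G) && (a \in A) by rewrite -LG mem_head.
have [b [c [u eA]]] := triple_through A3 aA.
by apply: (abundant_of_triples u LG _ cert_triple) => /= B; rewrite -eA.
Qed.

Lemma set3_swap (a b c : T) : [set:: [:: a; b; c]] = [set:: [:: a; c; b]].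
Proof. by apply/setP=> x; rewrite !inE; congr (_ || _); rewrite orbC. Qed.

Lemma uniq_cons_cat (a : T) (s r : seq T) :
  uniq (a :: s) -> uniq (a :: r) -> {in r, forall x, x \notin s} ->
  uniq (a :: s ++ r).
Proof.
move=> /= /andP[a_s us] /andP[a_r ur] sr.
by rewrite mem_cat negb_or a_s a_r cat_uniq us ur /= andbT; apply/hasPn => x /sr.
Qed.

Lemma tails_disjoint (a : T) (s r : seq T) :
  (forall x, ~~ [&& x != a, x \in [set:: a :: s] & x \in [set:: a :: r]]) ->
  uniq (a :: r) -> {in r, forall x, x \notin s}.
Proof.
move=> disj /= /andP[ar _] x xr; have := disj x.
have xa : x != a by apply: contraTneq xr => ->.
by rewrite !inE (negPf xa) xr /= andbT.
Qed.

Lemma abundant_of_two_triples (a : T) (A B : {set T}) :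
  (forall C, (C \in [:: A; B]) = (C \in G) && (a \in C)) ->
  #|A| = 3 -> #|B| = 3 -> A != B -> exists x, abundant x.
Proof.
move=> LG A3 B3 AB.
have aA : a \in A by have := LG A; rewrite !inE eqxx => /esym/andP[].
have aB : a \in B by have := LG B; rewrite !inE eqxx orbT => /esym/andP[].
(* Two distinct triples through [a] share exactly one further point or none. *)
case: (boolP [exists b, [&& b != a, b \in A & b \in B]]).
  case/existsP => b /and3P[ba bA bB]; rewrite eq_sym in ba.
  have [c u eA] := triple_through2 A3 ba aA bA.
  have [d v eB] := triple_through2 B3 ba aB bB.
  apply: (abundant_of_triples (s := [:: b; c; d]) _ LG _ cert_two_overlapping);
    last by move=> /= C; rewrite -eA -eB.
  have cd : c != d by apply: contra AB => /eqP cd; rewrite eA eB cd.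
  move: u; rewrite /= !inE negb_or !andbT => /andP[/andP[_ ac] bc].
  move: v; rewrite /= !inE negb_or !andbT => /andP[/andP[_ ad] bd].
  by rewrite !negb_or ba ac ad bc bd cd.
rewrite negb_exists => /forallP noAB.
have [b [c [u eA]]] := triple_through A3 aA.
have [d [f [v eB]]] := triple_through B3 aB.
apply: (abundant_of_triples (s := [:: b; c; d; f]) _ LG _ cert_two_disjoint);
  last by move=> /= C; rewrite -eA -eB.
apply: (@uniq_cons_cat a [:: b; c] [:: d; f]) => //.
by apply: (@tails_disjoint a) v; rewrite -eA -eB.
Qed.

(** Without [a], the triples [A] and [B] are the edges of a path [c], [b], [d]; the cases say where
    the edge left by [C] meets it. *)
Lemma abundant_of_overlapping_triples (a b : T) (A B C : {set T}) :
  (forall D, (D \in [:: A; B; C]) = (D \in G) && (a \in D)) ->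
  #|A| = 3 -> #|B| = 3 -> #|C| = 3 -> uniq [:: A; B; C] ->
  b != a -> b \in A -> b \in B -> exists x, abundant x.
Proof.
move=> LG A3 B3 C3 uABC ba bA bB; rewrite eq_sym in ba.
have aA : a \in A by have := LG A; rewrite !inE eqxx => /esym/andP[].
have aB : a \in B by have := LG B; rewrite !inE eqxx orbT => /esym/andP[].
have aC : a \in C by have := LG C; rewrite !inE eqxx !orbT => /esym/andP[].
move: uABC => /= /and3P[]; rewrite !inE negb_or => /andP[AB AC] BC _.
have [c u eA] := triple_through2 A3 ba aA bA.
have [d v eB] := triple_through2 B3 ba aB bB.
have cd : c != d by apply: contra AB => /eqP cd; rewrite eA eB cd.
move: u; rewrite /= !inE negb_or !andbT => /andP[/andP[_ ac] bc].
move: v; rewrite /= !inE negb_or !andbT => /andP[/andP[_ ad] bd].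
(* Through the centre [b]: a star. *)
case: (boolP (b \in C)) => bC.
  have [y w eC] := triple_through2 C3 ba aC bC.
  have cy : c != y by apply: contra AC => /eqP cy; rewrite eA eC cy.
  have dy : d != y by apply: contra BC => /eqP dy; rewrite eB eC dy.
  move: w; rewrite /= !inE negb_or !andbT => /andP[/andP[_ ay] yb].
  apply: (abundant_of_triples (s := [:: b; c; d; y]) _ LG _ cert_star).
    by rewrite /= !inE !negb_or ba ac ad ay bc bd yb cd cy dy.
  by move=> /= D; rewrite -eA -eB -eC.
(* Through the end [c]: a triangle if the other end is [d], else the path [d], [b], [c], [y]. *)
case: (boolP (c \in C)) => cC.
  have [y w eC] := triple_through2 C3 ac aC cC.
  move: w; rewrite /= !inE negb_or !andbT => /andP[/andP[_ ay] cy].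
  have yb : b != y by apply: contra bC => /eqP->; rewrite eC !inE eqxx !orbT.
  have [yd|dy] := eqVneq d y.
    rewrite -yd in eC.
    apply: (abundant_of_triples (s := [:: b; c; d]) _ LG _ cert_triangle).
      by rewrite /= !inE !negb_or ba ac ad bc bd cd.
    by move=> /= D; rewrite -eA -eB -eC.
  apply: (abundant_of_triples (s := [:: d; b; c; y]) _ LG _ cert_path).
    by rewrite /= !inE !negb_or ba ac ad ay bc yb cy dy ![d == _]eq_sym bd cd.
  move=> /= D; rewrite (set3_swap a d b) -eA -eB -eC !inE.
  by case: (D == A); case: (D == B).
(* Through [d] only: the path [c], [b], [d], [y]. *)
case: (boolP (d \in C)) => dC.
  have [y w eC] := triple_through2 C3 ad aC dC.
  move: w; rewrite /= !inE negb_or !andbT => /andP[/andP[_ ay] dy].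
  have yb : b != y by apply: contra bC => /eqP->; rewrite eC !inE eqxx !orbT.
  have yc : c != y by apply: contra cC => /eqP->; rewrite eC !inE eqxx !orbT.
  apply: (abundant_of_triples (s := [:: c; b; d; y]) _ LG _ cert_path).
    by rewrite /= !inE !negb_or ba ac ad ay bd yb dy yc cd eq_sym bc.
  by move=> /= D; rewrite (set3_swap a c b) -eA -eB -eC !inE.
(* Disjoint from the path. *)
have [x [y [w eC]]] := triple_through C3 aC.
apply: (abundant_of_triples (s := [:: b; c; d; x; y]) _ LG _ cert_path_edge);
  last by move=> /= D; rewrite -eA -eB -eC.
apply: (@uniq_cons_cat a [:: b; c; d] [:: x; y]) => //.
  by rewrite /= !inE !negb_or ba ac ad bc bd cd.
move=> z zxy; have zC : z \in C by rewrite eC inE in_cons zxy orbT.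
rewrite !inE !negb_or; apply/and3P.
by split; [move: bC | move: cC | move: dC]; apply: contra => /eqP<-.
Qed.

(** Up to reordering, two triples meet outside [a], or all three are pairwise disjoint there and
    form the matching. *)
Lemma abundant_of_three_triples (a : T) (A B C : {set T}) :
  (forall D, (D \in [:: A; B; C]) = (D \in G) && (a \in D)) ->
  #|A| = 3 -> #|B| = 3 -> #|C| = 3 -> uniq [:: A; B; C] ->
  exists x, abundant x.
Proof.
move=> LG A3 B3 C3 uABC.
have aA : a \in A by have := LG A; rewrite !inE eqxx => /esym/andP[].
have aB : a \in B by have := LG B; rewrite !inE eqxx orbT => /esym/andP[].
have aC : a \in C by have := LG C; rewrite !inE eqxx !orbT => /esym/andP[].
have permLG L : perm_eq L [:: A; B; C] ->
    forall D, (D \in L) = (D \in G) && (a \in D).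
  by move=> pL D; rewrite (perm_mem pL) LG.
case: (boolP [exists b, [&& b != a, b \in A & b \in B]]).
  case/existsP => b /and3P[ba bA bB].
  exact: (abundant_of_overlapping_triples LG A3 B3 C3 uABC ba bA bB).
rewrite negb_exists => /forallP noAB.
case: (boolP [exists b, [&& b != a, b \in A & b \in C]]).
  case/existsP => b /and3P[ba bA bC].
  have pL : perm_eq [:: A; C; B] [:: A; B; C] by rewrite perm_cons (perm_catC [:: C] [:: B]).
  apply: (abundant_of_overlapping_triples (permLG _ pL) A3 C3 B3 _ ba bA bC).
  by rewrite (perm_uniq pL).
rewrite negb_exists => /forallP noAC.
case: (boolP [exists b, [&& b != a, b \in B & b \in C]]).
  case/existsP => b /and3P[ba bB bC].
  have pL : perm_eq [:: B; C; A] [:: A; B; C] by rewrite (perm_catC [:: B; C] [:: A]).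
  apply: (abundant_of_overlapping_triples (permLG _ pL) B3 C3 A3 _ ba bB bC).
  by rewrite (perm_uniq pL).
rewrite negb_exists => /forallP noBC.
have [b [c [u eA]]] := triple_through A3 aA.
have [d [f [v eB]]] := triple_through B3 aB.
have [g [h [w eC]]] := triple_through C3 aC.
apply: (abundant_of_triples (s := [:: b; c; d; f; g; h]) _ LG _ cert_matching);
  last by move=> /= D; rewrite -eA -eB -eC.
apply: (@uniq_cons_cat a [:: b; c] [:: d; f; g; h]) => //.
  apply: (@uniq_cons_cat a [:: d; f] [:: g; h]) => //.
  by apply: (@tails_disjoint a) w; rewrite -eB -eC.
have AB := @tails_disjoint a [:: b; c] [:: d; f].
have AC := @tails_disjoint a [:: b; c] [:: g; h].
rewrite -eA -?eB -?eC in AB AC => x; rewrite -[_ :: _]/([:: d; f] ++ [:: g; h]).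
by rewrite mem_cat => /orP[]; [apply: AB | apply: AC].
Qed.

Lemma generated_abundant :
  G != set0 -> {in G, forall A : {set T}, 0 < #|A| <= 3} ->
  (forall x, #|[set A in G | x \in A]| <= 3) -> exists x, abundant x.
Proof.
move=> /set0Pn[A0 A0G] G3 deg3.
case: (boolP [exists A in G, #|A| <= 2]).
  case/exists_inP => A AG A2; apply: (abundant_of_small AG).
  by rewrite A2 andbT; case/andP: (G3 A AG).
rewrite negb_exists_in => /forall_inP G3'.
have {}G3 A : A \in G -> #|A| = 3.
  by move=> AG; apply/eqP; rewrite eqn_leq ltnNge G3' // andbT; case/andP: (G3 A AG).
have /card_gt0P[a aA0] : 0 < #|A0| by rewrite G3.
have := deg3 a; have uL := enum_uniq [set A in G | a \in A]; rewrite cardE.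
have LG D : (D \in enum [set A in G | a \in A]) = (D \in G) && (a \in D).
  by rewrite mem_enum inE.
have {}G3 D : D \in enum [set A in G | a \in A] -> #|D| = 3.
  by rewrite LG => /andP[/G3].
have A0L : A0 \in enum [set A in G | a \in A] by rewrite LG A0G.
(* The list contains [A0], and [deg3] limits it to three entries. *)
case: (enum _) uL LG G3 A0L => [|A [|B [|C []]]] // uL LG G3 _ _.
- by apply: (abundant_of_one_triple LG); rewrite G3 ?mem_head.
- apply: (abundant_of_two_triples LG); rewrite ?G3 ?inE ?eqxx ?orbT //.
  by case/andP: uL; rewrite inE.
by apply: (abundant_of_three_triples LG); rewrite ?G3 ?inE ?eqxx ?orbT.
Qed.

End Generated.

(** * Maximal stable sets of bipartite graphs *)

Section MaximalStable.

Variables (T : finType) (e : rel T).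
Hypotheses (esym : symmetric e) (eirr : irreflexive e).

Definition neighbors (x : T) : {set T} := [set y | e x y].

Lemma stableP (S : {set T}) :
  reflect {in S &, forall x y, ~~ e x y} (stable e S).
Proof.
apply: (iffP forall_inP) => [st x y xS yS | st x xS].
  by have /forall_inP := st x xS; apply.
by apply/forall_inP => y yS; apply: st.
Qed.

Lemma max_stableP (S : {set T}) :
  reflect (stable e S /\ forall x, x \notin S -> exists2 y, y \in S & e x y)
          (S \in max_stable_sets e).
Proof.
rewrite inE; apply: (iffP maxsetP) => [[st mS] | [st dom]]; split=> //.
  move=> x xS; case: (boolP [exists y in S, e x y]) => [/exists_inP//|].
  rewrite negb_exists_in => /forall_inP nox.
  suff eS : x |: S = S by case/negP: xS; rewrite -eS setU11.
  apply: mS; last exact: subsetUr.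
  apply/stableP => y z; rewrite !inE.
  move=> /orP[/eqP->|yS] /orP[/eqP->|zS]; rewrite ?eirr //; first exact: nox.
    by rewrite esym nox.
  by move/stableP: st; apply.
move=> B /stableP stB SB; apply/eqP; rewrite eqEsubset SB andbT.
apply/subsetP=> x xB; apply: contraT => /dom[y yS].
by rewrite (negPf (stB x y xB (subsetP SB y yS))).
Qed.

(** * The union-closed family of missed sets *)

Variables U W : {set T}.
Hypothesis UW : bipartition e U W.

Lemma mem_other_class (x : T) : (x \in W) = (x \notin U).
Proof.
case: UW => cover disj _ _; have := in_setT x; rewrite -cover inE.
case xU: (x \in U) => //= _.
by apply/negbTE; move: disj => /disjointFr ->.
Qed.

Lemma edge_class (x y : T) : e x y -> (x \in U) = (y \in W).
Proof.
move=> exy; case: UW => _ _ /stableP sU /stableP sW; rewrite mem_other_class.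
case xU: (x \in U); case yU: (y \in U) => //.
  by rewrite (negPf (sU x y xU yU)) in exy.
by have := sW x y; rewrite !mem_other_class xU yU exy => /(_ isT isT).
Qed.

Definition missed_sets : {set {set T}} := [set U :\: S | S in max_stable_sets e].

(** By stability and maximality, a vertex of [W] lies in [S] exactly when [S] misses all its
    neighbours. *)
Lemma stable_of_missed (S : {set T}) : S \in max_stable_sets e ->
  S = (U :\: (U :\: S)) :|: [set w in W | neighbors w \subset U :\: S].
Proof.
move=> /max_stableP[/stableP st dom]; apply/setP=> x; rewrite !inE mem_other_class.
case xU: (x \in U); rewrite ?andbT ?andbF ?orbF ?negbK //=.
apply/idP/subsetP => [xS y|sub]; rewrite ?inE.
  move=> exy; have yU : y \in U.
    by rewrite esym in exy; rewrite (edge_class exy) mem_other_class xU.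
  by rewrite yU andbT; apply: contraTN exy; apply: st.
apply: contraT => /dom[y yS exy].
by have := sub y; rewrite !inE exy yS => /(_ isT).
Qed.

Lemma missed_inj : {in max_stable_sets e &, injective (fun S => U :\: S)}.
Proof.
by move=> S S' /stable_of_missed + /stable_of_missed => eS eS' /= eUS;
  rewrite eS eS' eUS.
Qed.

(** By maximality a missed vertex has a neighbour [w] in [S], and stability makes [S] miss all
    neighbours of [w]. So the missed sets are exactly the unions of neighbourhoods of vertices of
    [W]. *)
Lemma missed_setsP (X : {set T}) :
  reflect (X \subset U /\ forall x, x \in X ->
             exists2 w, w \in W & (x \in neighbors w) && (neighbors w \subset X))
          (X \in missed_sets).
Proof.
apply: (iffP imsetP) => [[S /max_stableP[/stableP st dom] ->] | [XU gen]].
  split=> [|x /setDP[xU /dom[w wS exw]]]; first exact: subsetDl.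
  exists w; first by rewrite -(edge_class exw).
  rewrite inE esym exw; apply/subsetP=> y; rewrite !inE => ewy.
  have yS : y \notin S by apply: contraTN ewy; apply: st.
  by rewrite esym in ewy; rewrite yS (edge_class ewy) -(edge_class exw).
(* The only candidate, by [stable_of_missed]. *)
exists ((U :\: X) :|: [set w in W | neighbors w \subset X]); last first.
  apply/setP=> x; rewrite !inE mem_other_class.
  case xU: (x \in U); first by rewrite !andbT /= orbF negbK.
  by rewrite andbF; apply: contraFF xU; apply: (subsetP XU).
apply/max_stableP; split.
  apply/stableP=> x y; rewrite !inE => Hx Hy; apply/negP=> exy.
  have := edge_class exy; have eyx : e y x by rewrite esym.
  move: Hx Hy; rewrite !mem_other_class.
  case xU: (x \in U); case yU: (y \in U) => //=; rewrite ?andbT ?andbF ?orbF //=.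
    by move=> /negP xX /subsetP/(_ x); rewrite inE eyx => /(_ isT)/xX.
  by move=> /subsetP/(_ y); rewrite inE exy => yX /negP yX'; case: yX'; apply: yX.
move=> x; rewrite !inE mem_other_class; case xU: (x \in U); rewrite ?andbT ?andbF ?orbF ?negbK //=.
  move=> /gen[w wW /andP[]]; rewrite inE => ewx wX; exists w; last by rewrite esym.
  by rewrite !inE wW wX orbT.
move=> /subsetPn[y]; rewrite inE => exy yX; exists y => //.
by rewrite !inE yX -[y \in U]negbK -mem_other_class -(edge_class exy) xU.
Qed.

Lemma card_max_stable_missed (u : T) : u \in U ->
  #|[set S in max_stable_sets e | u \in S]| = #|[set X in missed_sets | u \notin X]|.
Proof.
move=> uU; rewrite -(card_in_imset (f := fun S => U :\: S)); last first.
  by move=> S S' /setIdP[mS _] /setIdP[mS' _]; apply: missed_inj.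
apply: eq_card => X; rewrite [RHS]inE; apply/imsetP/andP => [[S] | [/imsetP[S mS ->]]].
  by move=> /setIdP[mS uS] ->; rewrite imset_f // !inE uS.
by rewrite !inE uU andbT negbK => uS; exists S => //; apply/setIdP.
Qed.

Lemma frankl_side : subcubic e -> (exists x y, e x y) ->
  exists2 u, u \in U & in_at_most_half e u.
Proof.
move=> sub3 [x [y exy]].
(* Isolated vertices of [W] are left out to keep the generators nonempty. *)
pose G := [set neighbors w | w in W & neighbors w != set0].
have GP A : reflect (exists2 w, w \in W & A = neighbors w /\ A != set0) (A \in G).
  apply: (iffP imsetP) => [[w /setIdP[wW w0] ->]|[w wW [-> w0]]]; exists w => //.
  exact/setIdP.
have FU : {in missed_sets &, forall X Y, X :|: Y \in missed_sets}.
  move=> X Y /missed_setsP[XU Xgen] /missed_setsP[YU Ygen]; apply/missed_setsP; split.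
    by rewrite subUset XU.
  move=> z /setUP[/Xgen|/Ygen] [w wW /andP[zw sw]]; exists w => //; rewrite zw.
    exact: subset_trans sw (subsetUl _ _).
  exact: subset_trans sw (subsetUr _ _).
have GF : {subset G <= missed_sets}.
  move=> _ /GP[w wW [-> _]]; apply/missed_setsP; split=> [|z zw]; last by exists w; rewrite ?zw /=.
  by apply/subsetP=> z; rewrite inE esym => /edge_class->.
have FG X z : X \in missed_sets -> z \in X ->
    exists2 A, A \in G & (z \in A) && (A \subset X).
  move=> /missed_setsP[_ gen] /gen[w wW /andP[zw sw]]; exists (neighbors w); last by rewrite zw.
  by apply/GP; exists w => //; split=> //; apply/set0Pn; exists z.
have G0 : G != set0.
  have [w [z [wW ewz]]] : exists w z, w \in W /\ e w z.
    case xU: (x \in U); last by exists x, y; rewrite mem_other_class xU.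
    by exists y, x; rewrite esym -(edge_class exy).
  apply/set0Pn; exists (neighbors w); apply/GP; exists w => //; split=> //.
  by apply/set0Pn; exists z; rewrite inE.
have G3 : {in G, forall A : {set T}, 0 < #|A| <= 3}.
  by move=> _ /GP[w wW [-> w0]]; rewrite card_gt0 w0; apply: sub3.
(* Generators containing [z] are neighbourhoods of neighbours of [z]. *)
have deg3 z : #|[set A in G | z \in A]| <= 3.
  apply: leq_trans (sub3 z); rewrite /degree.
  apply: leq_trans (leq_imset_card neighbors [set w | e z w]).
  apply: subset_leq_card; apply/subsetP=> A /setIdP[/GP[w wW [-> _]]].
  by rewrite inE => ewz; apply: imset_f; rewrite inE esym.
have [u] := generated_abundant FU GF FG G0 G3 deg3; rewrite /abundant => uab.
have [A0 A0G] := set0Pn _ G0.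
(* The family is nonempty, so an abundant point lies in some member, hence in [U]. *)
have : 0 < #|[set X in missed_sets | u \in X]|.
  have : 0 < #|missed_sets| by apply/card_gt0P; exists A0; apply: GF.
  by move: uab; lia.
case/card_gt0P => X /setIdP[/missed_setsP[/subsetP XU _] /XU uU]; exists u => //.
rewrite /in_at_most_half card_max_stable_missed //.
rewrite -(card_in_imset missed_inj) -/missed_sets.
have := cardsID [set X : {set T} | u \in X] missed_sets.
have -> : missed_sets :&: [set X : {set T} | u \in X] = [set X in missed_sets | u \in X].
  by apply/setP=> Z; rewrite !inE.
have -> : missed_sets :\: [set X : {set T} | u \in X] = [set X in missed_sets | u \notin X].
  by apply/setP=> Z; rewrite !inE andbC.
move=> eF; move: uab.
by rewrite -eF !mul2n -!addnn leq_add2l leq_add2r.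
Qed.

End MaximalStable.

Theorem theorem12 (T : finType) (e : rel T) (U W : {set T}) :
  simple_graph e -> subcubic e -> bipartition e U W ->
  satisfies_frankl e U W.
Proof.
move=> [esym eirr] sub3 UW ex; split; first exact: (frankl_side esym eirr UW).
apply: (frankl_side esym eirr (W := U)) => //.
by case: UW => cover disj sU sW; split; rewrite // 1?setUC // disjoint_sym.
Qed.
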